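(* Let $k\in\{\mathbb{R},\mathbb{C}\}$ and let $f\in k\langle X_1,X_2\rangle$ be the symmetric noncommutative polynomial $$f(X_1,X_2)=X_1X_2^2X_1-X_2X_1^2X_2+1 .$$ Then $f$ satisfies condition (a) but does not satisfy condition (b), where: (a) for every nontrivial $k$-Hilbert space $\mathcal{H}$ (i.e. $\mathcal{H}\neq 0$) and all bounded self-adjoint operators $A_1,A_2$ on $\mathcal{H}$, the operator $f(A_1,A_2)$ is not negative semidefinite; (b) there exist $r\in\mathbb{N}$ and polynomials $g_1,\dots,g_r\in k\langle X_1,X_2\rangle$ such that $$\sum_{i=1}^r g_i^* f g_i\in 1+\mathrm{SoS}.$$ Hence the equivalence of the two analogous conditions for arbitrary symmetric polynomials (the non-Archimedean Nirgendsnegativsemidefinitheitsstellensatz) is not true: it is not the case that, for every symmetric polynomial $p\in k\langle X_1,\dots,X_m\rangle$, the condition ''$p(A_1,\dots,A_m)$ is not negative semidefinite for any nontrivial $k$-Hilbert space $\mathcal{H}$ and any bounded self-adjoint operators $A_1,\dots,A_m$ on $\mathcal{H}$'' is equivalent to the condition ''there exist $r\in\mathbb{N}$ and $g_1,\dots,g_r\in k\langle X_1,\dots,X_m\rangle$ with $\sum_{i=1}^r g_i^* p g_i\in 1+\mathrm{SoS}$''.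
   Context: Here $\mathbb{N}=\{1,2,\ldots\}$ and $k\langle X_1,\dots,X_m\rangle$ is the free (noncommutative) polynomial algebra over $k$ in the variables $X_1,\dots,X_m$, i.e. finite linear combinations $p=\sum_\omega p_\omega\,\omega$ of words $\omega$ in the $X_j$, the empty word being $1$. The involution is $p^*=\sum_\omega p_\omega^*\,\omega^*$, where $p_\omega^*$ is the complex conjugate of $p_\omega$ (so $p_\omega^*=p_\omega$ if $k=\mathbb{R}$) and $(X_{i_1}X_{i_2}\cdots X_{i_n})^*=X_{i_n}\cdots X_{i_2}X_{i_1}$; in particular $X_j^*=X_j$. A polynomial $p$ is symmetric if $p=p^*$. $\mathrm{SoS}=\{\sum_{i=1}^n g_i^*g_i : n\in\mathbb{N},\ g_i\in k\langle X_1,\dots,X_m\rangle\}$ and $1+\mathrm{SoS}=\{1+s : s\in\mathrm{SoS}\}$, taken in the polynomial algebra under consideration. Throughout, $k$-Hilbert spaces are assumed separable. For bounded self-adjoint operators $A_1,\dots,A_m$ on a $k$-Hilbert space $\mathcal{H}$, $p(A_1,\dots,A_m)$ is obtained by substituting $A_j$ for $X_j$, with the empty word evaluated to the identity operator $\mathrm{Id}_{\mathcal{H}}$. A bounded self-adjoint operator $T$ on $\mathcal{H}$ is negative semidefinite if $\langle Tv,v\rangle\le 0$ for all $v\in\mathcal{H}$. *)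

(* Defs.v *)
From HB Require Import structures.
From mathcomp Require Import all_boot all_order all_algebra.
From mathcomp Require Import sesquilinear complex.
From mathcomp Require Import finmap monalg.
From mathcomp Require Import all_classical all_reals all_analysis.

Set Implicit Arguments.
Unset Strict Implicit.
Unset Printing Implicit Defensive.

Import Order.TTheory GRing.Theory Num.Theory.
Import numFieldNormedType.Exports.

Local Open Scope classical_set_scope.
Local Open Scope ring_scope.

Variant ground_field := RealField | ComplexField.

Definition scalars (R : realType) (k : ground_field) : numFieldType :=
  match k with
  | RealField => R
  | ComplexField => R[i]
  end.

Definition scalars_conj (R : realType) (k : ground_field) :
    {rmorphism scalars R k -> scalars R k} :=
  match k return {rmorphism scalars R k -> scalars R k} with
  | RealField => idfun
  | ComplexField => Num.conj
  end.

(* Below, the scalar field K and its conjugation theta are kept abstract; the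
   intended instances are scalars R k and scalars_conj R k. *)

(* The free algebra K<X_1, ..., X_m> is the monoid algebra over the free monoid
   of words in the letters 'I_m: the variable X_(j+1) is the word [:: j]. *)
Notation ncpoly K m := {malg K[{fmonom 'I_m}]}.

Definition ncvar (K : numFieldType) (m : nat) (j : 'I_m) : ncpoly K m :=
  << fmu j >>.

Definition ncstar (K : numFieldType) (theta : {rmorphism K -> K}) (m : nat)
    (p : ncpoly K m) : ncpoly K m :=
  \sum_(w <- msupp p) << theta p@_w *g FMonom (rev w) >>.

Definition ncsymmetric (K : numFieldType) (theta : {rmorphism K -> K})
    (m : nat) (p : ncpoly K m) : Prop :=
  p = ncstar theta p.

Definition SoS (K : numFieldType) (theta : {rmorphism K -> K}) (m : nat) :
    set (ncpoly K m) :=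
  [set s | exists n (g : 'I_n -> ncpoly K m),
     (0 < n)%N /\ s = \sum_(i < n) ncstar theta (g i) * g i].

Definition one_plus_SoS (K : numFieldType) (theta : {rmorphism K -> K})
    (m : nat) : set (ncpoly K m) :=
  [set 1 + s | s in @SoS K theta m].

(* The inner product is linear in its first argument and theta-semilinear in
   the second one, and it induces the (K-valued) norm of the Banach space. *)
Record hilbertType (K : numFieldType) (theta : {rmorphism K -> K}) :=
  HilbertType {
    hilbert_sort :> completeNormedModType K;
    dotp : {dot hilbert_sort for theta};
    dotp_norm : forall v : hilbert_sort, `|v| ^+ 2 = dotp v v
  }.

Definition separable (T : topologicalType) : Prop :=
  exists2 D : set T, countable D & dense D.

Definition bounded_operator (K : numFieldType) (H : normedModType K)
    (T : H -> H) : Prop :=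
  exists M : K, forall v : H, `|T v| <= M * `|v|.

Definition self_adjoint (K : numFieldType) (theta : {rmorphism K -> K})
    (H : hilbertType theta) (T : H -> H) : Prop :=
  forall u v : H, dotp H (T u) v = dotp H u (T v).

(* In R[i], x <= 0 means that x is a nonpositive real number. *)
Definition negative_semidefinite (K : numFieldType)
    (theta : {rmorphism K -> K}) (H : hilbertType theta) (T : H -> H) : Prop :=
  forall v : H, dotp H (T v) v <= 0.

Definition nceval (K : numFieldType) (H : lmodType K) (m : nat)
    (p : ncpoly K m) (A : 'I_m -> {linear H -> H}) (v : H) : H :=
  \sum_(w <- msupp p) p@_w *: foldr (fun j u => A j u) v w.

Definition nowhere_negative_semidefinite (K : numFieldType)
    (theta : {rmorphism K -> K}) (m : nat) (p : ncpoly K m) : Prop :=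
  forall H : hilbertType theta, separable H -> (exists v : H, v != 0) ->
  forall A : 'I_m -> {linear H -> H},
  (forall j, bounded_operator (A j)) ->
  (forall j, @self_adjoint K theta H (A j)) ->
  ~ @negative_semidefinite K theta H (nceval p A).

Definition has_sos_certificate (K : numFieldType)
    (theta : {rmorphism K -> K}) (m : nat) (p : ncpoly K m) : Prop :=
  exists r (g : 'I_r -> ncpoly K m), (0 < r)%N /\
    one_plus_SoS theta (\sum_(i < r) ncstar theta (g i) * p * g i).

Definition counterexample (K : numFieldType) : ncpoly K 2 :=
  let X1 := ncvar K (ord0 : 'I_2) in
  let X2 := ncvar K (ord_max : 'I_2) in
  X1 * X2 ^+ 2 * X1 - X2 * X1 ^+ 2 * X2 + 1.

(* Main.v *)
Require Import Defs.
From HB Require Import structures.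
From mathcomp Require Import all_boot all_order all_algebra.
From mathcomp Require Import sesquilinear complex.
From mathcomp Require Import finmap monalg.
From mathcomp Require Import all_classical all_reals all_analysis.
From mathcomp Require Import ring.

Set Implicit Arguments.
Unset Strict Implicit.
Unset Printing Implicit Defensive.

Import Order.TTheory GRing.Theory Num.Theory.
Local Open Scope ring_scope.

(** With T := A1 A2, whose adjoint is S := A2 A1, the operator f(A1, A2) is
    S^* S - T^* T + 1, so f(A1, A2) is negative semidefinite exactly when
    |S v|^2 + |v|^2 <= |T v|^2 for all v. Boundedness decides whether such a
    pair exists.

    - For bounded operators it does not: T and S have the same norm c, and the
      inequality would give c^2 + 1 <= c^2 on a nonzero space. Since only an
      upper bound for T is at hand, [bounded_gap_trivial] runs this as a
      descent: any bound n for |T v|^2 / |v|^2 improves to n - 1.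

    - For unbounded operators it does: on finitely supported sequences let
      A1 e_n = 2^n e_n and A2 e_n = e_(n-1) + e_(n+1). The geometric weights
      cancel every off-diagonal entry, and f(A1, A2) becomes the diagonal
      operator with entries -2 at n = 0 and 1 - 9 * 4^(n-1) at n > 0, all
      negative ([coef_counterexample]).

    The second pair forbids a certificate. Although the operators are unbounded,
    they act on a common invariant domain, so polynomials in them can be
    evaluated and the involution becomes the formal adjoint. Evaluating
    sum g_i^* f g_i = 1 + sum h_j^* h_j at a vector v and pairing with v gives
    sum <f u_i, u_i> <= 0 with u_i = g_i v on the left, and at least
    <v, v> > 0 on the right ([no_sos_certificate]). *)

(** * Additive maps out of a monoid algebra *)

Section MonomialSum.
Variables (I : choiceType) (G V : zmodType) (F : G -> I -> V).
Hypothesis F_B : forall w, {morph F^~ w : x y / x - y}.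

(** The additive extension of F from monomials to the whole algebra; both the
    evaluation at operators and the involution have this form. *)
Definition monomial_sum (p : {malg G[I]}) : V := \sum_(w <- msupp p) F p@_w w.

Let F_0 w : F 0 w = 0.
Proof. by rewrite -[0 in LHS](subrr 0) F_B subrr. Qed.

Lemma monomial_sumEw (d : {fset I}) p : (msupp p `<=` d)%fset ->
  monomial_sum p = \sum_(w <- d) F p@_w w.
Proof.
move=> pd; apply: big_fset_incl => // w _ wp.
by rewrite mcoeff_outdom.
Qed.

Lemma monomial_sumU c w : monomial_sum << c *g w >> = F c w.
Proof. by rewrite (monomial_sumEw msuppU_le) big_seq_fset1 mcoeffUU. Qed.

Lemma monomial_sumB : {morph monomial_sum : p q / p - q}.
Proof.
move=> p q; rewrite (monomial_sumEw (msuppB_le _ _)).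
rewrite (monomial_sumEw (fsubsetUl (msupp p) (msupp q))).
rewrite (monomial_sumEw (fsubsetUr (msupp p) (msupp q))) -sumrB.
by apply: eq_bigr => w _; rewrite mcoeffB F_B.
Qed.

End MonomialSum.

(** * Evaluation and involution *)

Section Evaluation.
Variables (K : numFieldType) (V : lmodType K) (m : nat).
Variable A : 'I_m -> {linear V -> V}.
Implicit Types (p q : ncpoly K m) (v : V).

Definition word_action (w : seq 'I_m) (v : V) := foldr (fun j u => A j u) v w.

Lemma word_action_linear w : linear (word_action w).
Proof. by move=> a u v; elim: w => //= j w ->; rewrite linearP. Qed.

HB.instance Definition _ w :=
  GRing.isLinear.Build K V V *:%R (word_action w) (word_action_linear w).

Let nceval_monomial v (c : K) (w : {fmonom 'I_m}) := c *: word_action w v.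

Let nceval_monomialB v w : {morph (nceval_monomial v)^~ w : x y / x - y}.
Proof. by move=> x y; rewrite /nceval_monomial scalerBl. Qed.

Let ncevalE p v : nceval p A v = monomial_sum (nceval_monomial v) p.
Proof. by []. Qed.

Lemma ncevalU c w v : nceval << c *g w >> A v = c *: word_action w v.
Proof. by rewrite ncevalE monomial_sumU. Qed.

Lemma ncevalB p q v : nceval (p - q) A v = nceval p A v - nceval q A v.
Proof. by rewrite !ncevalE monomial_sumB. Qed.

Lemma nceval0 v : nceval 0 A v = 0.
Proof. by rewrite -[0 in LHS](subrr 0) ncevalB subrr. Qed.

Lemma ncevalD p q v : nceval (p + q) A v = nceval p A v + nceval q A v.
Proof.
by rewrite -[q in LHS]opprK ncevalB -[- q]sub0r ncevalB nceval0 sub0r opprK.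
Qed.

Lemma nceval_sum (J : Type) (r : seq J) (P : pred J) (F : J -> ncpoly K m) v :
  nceval (\sum_(i <- r | P i) F i) A v = \sum_(i <- r | P i) nceval (F i) A v.
Proof.
apply: (big_morph (fun p => nceval p A v)) => [p q|]; first exact: ncevalD.
exact: nceval0.
Qed.

Lemma nceval1 v : nceval 1 A v = v.
Proof. by rewrite ncevalU scale1r /word_action fm1. Qed.

Lemma nceval_var j v : nceval (ncvar K j) A v = A j v.
Proof. by rewrite ncevalU scale1r /word_action fmuE. Qed.

Lemma ncevalM p q v : nceval (p * q) A v = nceval p A (nceval q A v).
Proof.
rewrite malgME nceval_sum; apply: eq_bigr => w _.
rewrite nceval_sum -/(word_action w _) linear_sum scaler_sumr.
apply: eq_bigr => w' _; rewrite ncevalU linearZ /= scalerA.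
by rewrite /word_action fmM foldr_cat.
Qed.

(** Moving a word across the form one symmetric letter at a time reverses it,
    and moving a coefficient across conjugates it: this is the involution. *)
Lemma nceval_adjoint (theta : {rmorphism K -> K})
    (form : {bilinear V -> V -> K | *%R & theta \; *%R}) p u v :
  (forall j x y, form (A j x) y = form x (A j y)) ->
  form (nceval (ncstar theta p) A u) v = form u (nceval p A v).
Proof.
move=> A_sym; rewrite nceval_sum linear_sumlz linear_sumr.
apply: eq_bigr => w _; rewrite ncevalU linearZl_LR linearZr_LR /=.
congr (_ * _).
elim: (fmonom_val w) u => //= j s IHs u.
by rewrite /word_action rev_cons foldr_rcons IHs A_sym.
Qed.

End Evaluation.

Lemma nceval_counterexample (K : numFieldType) (V : lmodType K)
    (A : 'I_2 -> {linear V -> V}) (v : V) :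
  let A1 := A ord0 in let A2 := A ord_max in
  nceval (counterexample K) A v = A1 (A2 (A2 (A1 v))) - A2 (A1 (A1 (A2 v))) + v.
Proof.
move=> A1 A2.
pose x := ncvar K (ord0 : 'I_2); pose y := ncvar K (ord_max : 'I_2).
have eval (p q : ncpoly K 2) (P Q : V -> V) :
    (forall u, nceval p A u = P u) -> (forall u, nceval q A u = Q u) ->
    nceval (p * (q * q) * p) A v = P (Q (Q (P v))).
  move=> pP qQ; rewrite (ncevalM _ (p * (q * q)) p) (ncevalM _ p (q * q)).
  by rewrite (ncevalM _ q q) !pP !qQ.
have xA1 u : nceval x A u = A1 u by exact: nceval_var.
have yA2 u : nceval y A u = A2 u by exact: nceval_var.
have xyyx := eval x y A1 A2 xA1 yA2; have yxxy := eval y x A2 A1 yA2 xA1.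
apply: etrans (ncevalD A (x * (y * y) * x - y * (x * x) * y) 1 v) _.
rewrite nceval1; congr (_ + v).
apply: etrans (ncevalB A (x * (y * y) * x) (y * (x * x) * y) v) _.
exact: (congr2 (fun a b => a - b) xyyx yxxy).
Qed.

(** * An obstruction to certificates *)

(** The space is only pre-Hilbert and the operators A j need not be bounded:
    a certificate is a polynomial identity, so it holds on any common invariant
    domain of symmetric operators. *)
Lemma no_sos_certificate (K : numFieldType) (theta : {rmorphism K -> K})
    (m : nat) (p : ncpoly K m) (V : lmodType K)
    (form : {bilinear V -> V -> K | *%R & theta \; *%R})
    (A : 'I_m -> {linear V -> V}) (v : V) :
  (forall u, 0 <= form u u) ->
  (forall j x y, form (A j x) y = form x (A j y)) ->
  (forall u, form (nceval p A u) u <= 0) ->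
  0 < form v v -> ~ has_sos_certificate theta p.
Proof.
move=> form_ge0 A_sym p_le0 v_gt0 [r [g [_ [_ [n [h [_ ->]]] cert]]]].
have := congr1 (fun q => form (nceval q A v) v) cert.
rewrite ncevalD nceval1 linearDl !nceval_sum !linear_sumlz.
apply/eqP; rewrite eq_sym lt_eqF//.
apply: (@le_lt_trans _ _ 0).
  by apply: sumr_le0 => i _; rewrite -mulrA !ncevalM nceval_adjoint.
rewrite ltr_wpDr// sumr_ge0// => i _.
by rewrite ncevalM nceval_adjoint.
Qed.

(** * A pair of symmetric unbounded operators *)

Section FiniteSequences.
Variables (K : numFieldType) (theta : {rmorphism K -> K}).
Implicit Types p q : {poly K}.

(** The coefficients of a polynomial stand for a finitely supported sequence,
    and this is its standard inner product. *)
Definition coef_form p q : K := \sum_(i < size p) p`_i * theta q`_i.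

Lemma coef_formEw n p q : (size p <= n)%N ->
  coef_form p q = \sum_(i < n) p`_i * theta q`_i.
Proof.
move=> pn; rewrite /coef_form (big_ord_widen _ (fun i => p`_i * theta q`_i) pn).
rewrite big_mkcond; apply: eq_bigr => i _; case: ltnP => // ip.
by rewrite nth_default// mul0r.
Qed.

Lemma coef_form_bilinear : bilinear_for
  (GRing.Scale.Law.clone _ _ *%R _) (GRing.Scale.Law.clone _ _ (theta \; *%R) _)
  coef_form.
Proof.
split=> [q a p p'|p a q q'] /=.
  set n := maxn (size p) (size p').
  have pn : (size p <= n)%N by rewrite leq_maxl.
  have pn' : (size p' <= n)%N by rewrite leq_maxr.
  have ppn : (size (a *: p + p')%R <= n)%N.
    rewrite (leq_trans (size_polyD _ _))// geq_max pn' andbT.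
    exact: leq_trans (size_scale_leq _ _) pn.
  rewrite !(coef_formEw _ pn, coef_formEw _ pn', coef_formEw _ ppn).
  rewrite mulr_sumr -big_split; apply: eq_bigr => i _ /=.
  by rewrite coefD coefZ mulrDl mulrA.
rewrite /coef_form mulr_sumr -big_split; apply: eq_bigr => i _ /=.
by rewrite coefD coefZ rmorphD rmorphM /=; ring.
Qed.

HB.instance Definition _ := bilinear_isBilinear.Build K {poly K} {poly K} K
  _ _ coef_form coef_form_bilinear.

Definition dilation p : {poly K} := \poly_(i < size p) (2 ^+ i * p`_i).

Lemma coef_dilation p i : (dilation p)`_i = 2 ^+ i * p`_i.
Proof.
by rewrite coef_poly; case: ltnP => // ip; rewrite nth_default// mulr0.
Qed.

Lemma dilation_linear : linear dilation.
Proof.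
move=> a p q; apply/polyP => i.
by rewrite coef_dilation coefD [RHS]coefD !coefZ !coef_dilation; ring.
Qed.

HB.instance Definition _ :=
  GRing.isLinear.Build K {poly K} {poly K} *:%R dilation dilation_linear.

Definition two_sided_shift p : {poly K} := p * 'X + drop_poly 1 p.

Lemma coef_two_sided_shift p i :
  (two_sided_shift p)`_i = (if i is j.+1 then p`_j else 0) + p`_i.+1.
Proof. by rewrite coefD coefMX coef_drop_poly addn1; case: i. Qed.

Lemma two_sided_shift_linear : linear two_sided_shift.
Proof.
by move=> a p q; apply/polyP => -[|i];
  rewrite coef_two_sided_shift [RHS]coefD coefZ !coef_two_sided_shift /=;
  rewrite !(coefD, coefZ); ring.
Qed.

HB.instance Definition _ := GRing.isLinear.Build K {poly K} {poly K} *:%R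
  two_sided_shift two_sided_shift_linear.

Definition shift_pair (j : 'I_2) : {linear {poly K} -> {poly K}} :=
  if j == ord0 then (dilation : {linear {poly K} -> {poly K}})
  else two_sided_shift.

Lemma dilation_symmetric p q :
  coef_form (dilation p) q = coef_form p (dilation q).
Proof.
rewrite (coef_formEw _ (size_poly _ _)); apply: eq_bigr => i _.
by rewrite !coef_dilation rmorphM rmorphXn rmorph_nat /=; ring.
Qed.

(** The forward and backward shifts are formal adjoints of each other; hence
    their sum is symmetric. *)
Lemma coef_formMX p q : coef_form (p * 'X) q = coef_form p (drop_poly 1 q).
Proof.
have szX : (size (p * 'X)%R <= (size p).+1)%N.
  by rewrite (leq_trans (size_polyMleq _ _))// size_polyX addn2.
rewrite (coef_formEw _ szX) big_ord_recl coefMX mul0r add0r.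
by apply: eq_bigr => i _; rewrite coefMX coef_drop_poly addn1.
Qed.

Lemma coef_form_drop p q : coef_form (drop_poly 1 p) q = coef_form p (q * 'X).
Proof.
have szd : (size (drop_poly 1 p) <= size p)%N.
  by rewrite size_drop_poly leq_subr.
rewrite (coef_formEw _ szd) (coef_formEw _ (leqnSn _)).
rewrite big_ord_recl coefMX rmorph0 mulr0 add0r.
by apply: eq_bigr => i _; rewrite coefMX coef_drop_poly addn1.
Qed.

Lemma two_sided_shift_symmetric p q :
  coef_form (two_sided_shift p) q = coef_form p (two_sided_shift q).
Proof.
rewrite /two_sided_shift [LHS]linearDl [RHS]linearDr /=.
by rewrite [X in X + _]coef_formMX [X in _ + X]coef_form_drop addrC.
Qed.

(** For a diagonal A1 with entries a_n, the entry of f(A1, A2) linking n to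
    n + 2 is a_n a_(n+2) - a_(n+1)^2, which vanishes for a_n = 2^n. *)
Lemma coef_counterexample p i :
  (nceval (counterexample K) shift_pair p)`_i =
  - (if i is j.+1 then 9 * 4 ^+ j - 1 else 2) * p`_i.
Proof.
rewrite nceval_counterexample.
have exp4 n : 4 ^+ n = 2 ^+ n * 2 ^+ n :> K by rewrite -exprMn -natrM.
rewrite /shift_pair /= coefD coefB.
by case: i => [|[|i]];
  rewrite !(coef_dilation, coef_two_sided_shift) /= ?exp4 ?exprS; ring.
Qed.

Lemma counterexample_uncertified :
  (forall x : K, 0 <= x * theta x) ->
  ~ has_sos_certificate theta (counterexample K).
Proof.
move=> theta_ge0.
have form_ge0 p : 0 <= coef_form p p by apply: sumr_ge0 => i _.
apply: (@no_sos_certificate _ theta 2 _ _ coef_form shift_pair 1) => //.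
- move=> j p q; rewrite /shift_pair; case: (j == ord0).
    exact: dilation_symmetric.
  exact: two_sided_shift_symmetric.
- move=> p; set q := nceval _ _ _.
  have qp : (size q <= size p)%N.
    apply/leq_sizeP => i ip.
    by rewrite coef_counterexample nth_default ?mulr0.
  rewrite -[leLHS]/(coef_form q p) (coef_formEw _ qp); apply: sumr_le0 => i _.
  rewrite coef_counterexample -mulrA mulNr oppr_le0 mulr_ge0//.
  case: (nat_of_ord i) => // j; rewrite subr_ge0.
  by rewrite -natrX -natrM ler1n muln_gt0 expn_gt0.
- rewrite -[ltRHS]/(coef_form 1 1) /coef_form size_poly1 big_ord1 coef1.
  by rewrite rmorph_nat mulr1.
Qed.

End FiniteSequences.

(** * Boundedness *)

(** A bound |T v|^2 <= (d + 1) |v|^2 gives |S u|^2 <= d |u|^2 on the range of T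
    by the gap. Expanding 0 <= |S T u - d u|^2, where both cross terms are
    d |T u|^2, then gives |T u|^2 <= d |u|^2. This square completion replaces
    the Cauchy-Schwarz inequality and works over a partially ordered field. *)
Lemma bounded_gap_trivial (K : numFieldType) (theta : {rmorphism K -> K})
    (V : lmodType K) (form : {hermitian_sym V for theta}) (T S : V -> V)
    (n : nat) :
  (forall v, 0 <= form v v) ->
  (forall u v, form (T u) v = form u (S v)) ->
  (forall v, form (S v) (S v) + form v v <= form (T v) (T v)) ->
  (forall v, form (T v) (T v) <= n%:R * form v v) ->
  forall v, form v v = 0.
Proof.
move=> form_ge0 adj gap bound v.
have formZl (c : K) x y : form (c *: x) y = c * form x y.
  exact: linearZl_LR.
have formZr (d : nat) x y : form x (d%:R *: y) = d%:R * form x y.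
  by rewrite linearZr_LR /= rmorph_nat.
have formBl x y z : form (x - y) z = form x z - form y z.
  exact: linearBl.
have formBr x y z : form x (y - z) = form x y - form x z.
  exact: linearBr.
have key (d : nat) u : 2 * d%:R * form (T u) (T u) <=
    form (S (T u)) (S (T u)) + d%:R ^+ 2 * form u u.
  have STu : form u (S (T u)) = form (T u) (T u) by rewrite adj.
  have TSu : form (S (T u)) u = form (T u) (T u).
    by rewrite hermC mul1r STu [RHS]hermC mul1r.
  have -> : form (S (T u)) (S (T u)) + d%:R ^+ 2 * form u u =
      form (S (T u) - d%:R *: u) (S (T u) - d%:R *: u) +
      2 * d%:R * form (T u) (T u).
    by rewrite formBl !formBr !formZl !formZr STu TSu; ring.
  by rewrite lerDr.
(* The division by d.+1 confines the descent to bounds greater than 1. *)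
have step d : (forall u, form (T u) (T u) <= d.+2%:R * form u u) ->
    forall u, form (T u) (T u) <= d.+1%:R * form u u.
  move=> Td u; rewrite -(@ler_pM2l _ d.+1%:R) ?ltr0n//.
  have := le_trans (gap (T u)) (Td (T u)).
  rewrite [in X in _ <= X]mulrSr mulrDl mul1r lerD2r => STu.
  have := le_trans (key d.+1 u) (lerD STu (lexx _)).
  by rewrite -mulrA mulr_natl mulr2n lerD2l expr2 mulrA.
have {n bound} bound u : form (T u) (T u) <= form u u.
  have bound1 : forall u, form (T u) (T u) <= n.+1%:R * form u u.
    by move=> w; rewrite (le_trans (bound w))// ler_wpM2r// ler_nat.
  elim: n bound1 {bound} => [|n IHn] bound1; last exact/IHn/step.
  by rewrite -[leRHS]mul1r.
(* The bound 1 leaves no room for the gap unless S = 0; then T vanishes too,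
   which the square completion expresses with d = 1. *)
have S0 u : form (S u) (S u) <= 0.
  by rewrite -(lerD2r (form u u)) add0r (le_trans (gap u)).
have vT : form v v <= form (T v) (T v).
  by rewrite (le_trans _ (gap v))// lerDr.
apply/eqP; rewrite eq_le form_ge0 andbT.
have := le_trans (key 1%N v) (lerD (S0 _) (lexx _)).
rewrite expr1n mulr1 mul1r add0r mulr_natl mulr2n => TT.
rewrite -(lerD2r (form v v)) add0r.
exact: le_trans (lerD vT vT) TT.
Qed.

Lemma counterexample_nowhere_negative (K : numFieldType)
    (theta : {rmorphism K -> K}) :
  (forall x : K, 0 <= x -> exists n : nat, x <= n%:R) ->
  nowhere_negative_semidefinite theta (counterexample K).
Proof.
move=> arch H _ [v v_neq0] A A_bounded A_sym f_le0.
have dot_ge0 (u : H) : 0 <= dotp H u u.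
  by rewrite -dotp_norm exprn_ge0.
(* On a nonzero space a bound is automatically nonnegative. *)
have A_bound j : exists2 M : K, 0 <= M & forall u : H, `|A j u| <= M * `|u|.
  have [M AM] := A_bounded j; exists M => //.
  by rewrite -(pmulr_lge0 _ (_ : 0 < `|v|)) ?normr_gt0// (le_trans _ (AM v)).
have [M M_ge0 AM] := A_bound ord0.
have [N N_ge0 AN] := A_bound ord_max.
have [n MNn] := arch _ (exprn_ge0 2 (mulr_ge0 M_ge0 N_ge0)).
pose T u := A ord0 (A ord_max u).
pose S u := A ord_max (A ord0 u).
suff v0 : dotp H v v = 0.
  by move: v_neq0; rewrite -normr_eq0 -sqrf_eq0 dotp_norm v0 eqxx.
apply: (@bounded_gap_trivial _ _ _ (dotp H) T S n) => //.
- move=> u w; rewrite /T /S.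
  exact: etrans (A_sym _ _ _) (A_sym _ _ _).
- move=> u; have := f_le0 u.
  rewrite nceval_counterexample.
  have dotDl (x y z : H) : dotp H (x + y) z = dotp H x z + dotp H y z.
    exact: linearDl.
  have dotBl (x y z : H) : dotp H (x - y) z = dotp H x z - dotp H y z.
    exact: linearBl.
  rewrite dotDl dotBl.
  have -> : dotp H (A ord0 (A ord_max (S u))) u = dotp H (S u) (S u).
    by rewrite A_sym A_sym.
  have -> : dotp H (A ord_max (A ord0 (T u))) u = dotp H (T u) (T u).
    by rewrite A_sym A_sym.
  by rewrite addrAC subr_le0; apply.
- move=> u.
  have Tu : `|T u| <= M * N * `|u|.
    by rewrite -mulrA (le_trans (AM _))// ler_wpM2l.
  have dotp_le : dotp H (T u) (T u) <= n%:R * dotp H u u.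
    rewrite -!dotp_norm (le_trans (_ : _ <= (M * N * `|u|) ^+ 2))//.
      by rewrite ler_pXn2r ?nnegrE ?mulr_ge0.
    by rewrite exprMn ler_wpM2r ?exprn_ge0.
  exact: dotp_le.
Qed.

(** * Symmetry *)

Lemma counterexample_symmetric (K : numFieldType) (theta : {rmorphism K -> K}) :
  ncsymmetric theta (counterexample K).
Proof.
pose X (w : seq 'I_2) : ncpoly K 2 := << FMonom w >>.
have XM w w' : X w * X w' = X (w ++ w').
  rewrite /X malgM_def fgmulUU mulr1; congr << _ >>.
  by apply/eqP; rewrite fmP fmM.
have varE j : ncvar K j = X [:: j] by rewrite /ncvar fmuE.
have oneE : 1 = X [::] by rewrite /X -fmoneE.
have -> : counterexample K = X [:: ord0; ord_max; ord_max; ord0] -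
    X [:: ord_max; ord0; ord0; ord_max] - (- X [::]).
  have mono i j :
      X [:: i] * (X [:: j] * X [:: j]) * X [:: i] = X [:: i; j; j; i].
    apply: etrans (XM [:: i; j; j] [:: i]); congr (_ * _).
    by apply: etrans (XM [:: i] [:: j; j]); congr (_ * _); exact: XM.
  rewrite /counterexample opprK oneE !varE.
  exact: (congr2 (fun p q => p - q + X [::]) (mono _ _) (mono _ _)).
pose star (c : K) (w : {fmonom 'I_2}) : ncpoly K 2 :=
  << theta c *g FMonom (rev w) >>.
have starB w : {morph star^~ w : x y / x - y}.
  by move=> x y; rewrite /star rmorphB monalgUB.
have starX w : monomial_sum star (X w) = X (rev w).
  apply: etrans (monomial_sumU starB 1 (FMonom w)) _.
  by rewrite /star rmorph1.
have star_sub := monomial_sumB starB.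
have star0 : monomial_sum star 0 = 0.
  by rewrite -[0 in LHS](subrr (X [::])) star_sub subrr.
apply/esym; apply: etrans (star_sub _ (- X [::])) _.
congr (_ - _); last first.
  by rewrite -[- X [::]]sub0r star_sub star0; congr (_ - _); exact: starX.
apply: etrans (star_sub (X _) (X _)) _.
by congr (_ - _); exact: starX.
Qed.

(** * The scalars *)

Lemma scalars_conj_ge0 (R : realType) (k : ground_field) (x : scalars R k) :
  0 <= x * scalars_conj R k x.
Proof.
case: k x => x /=; first by rewrite -expr2 sqr_ge0.
exact: mul_conjC_ge0.
Qed.

Lemma scalars_archimedean (R : realType) (k : ground_field) (x : scalars R k) :
  0 <= x -> exists n : nat, x <= n%:R.
Proof.
case: k x => x /= x_ge0.
  by exists (Num.bound x); exact/ltW/archi_boundP.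
case: x x_ge0 => a b; rewrite lecE /= => /andP[b0 a_ge0].
exists (Num.bound a); rewrite -[_%:R](rmorph_nat (real_complex R)).
rewrite lecE /= eq_sym b0; exact/ltW/archi_boundP.
Qed.

Theorem theorem2p1 (R : realType) (k : ground_field) :
  let f := counterexample (scalars R k) in
  [/\ ncsymmetric (scalars_conj R k) f,
      nowhere_negative_semidefinite (scalars_conj R k) f,
      ~ has_sos_certificate (scalars_conj R k) f &
      ~ (forall (m : nat) (p : ncpoly (scalars R k) m), (0 < m)%N ->
           ncsymmetric (scalars_conj R k) p ->
           (nowhere_negative_semidefinite (scalars_conj R k) p <->
            has_sos_certificate (scalars_conj R k) p))].
Proof.
move=> f.
have f_sym : ncsymmetric (scalars_conj R k) f.
  exact: counterexample_symmetric.
have f_nowhere : nowhere_negative_semidefinite (scalars_conj R k) f.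
  exact/counterexample_nowhere_negative/scalars_archimedean.
have f_uncertified : ~ has_sos_certificate (scalars_conj R k) f.
  exact/counterexample_uncertified/scalars_conj_ge0.
split=> // equiv; apply: f_uncertified.
exact/(equiv 2%N f isT f_sym).
Qed.
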